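(* Let $\alpha\in[0,1]$ and let $B'\subseteq\mathbb{N}$ be a highly sparse set. Set $B:=\{0\}\cup B'$. Then there exists a set $A\subset\mathbb{N}$ such that $d(A+B)=\alpha$.
   Context: $\mathbb{N}=\{1,2,3,\ldots\}$. For sets $X,Y$ of nonnegative integers, $X+Y=\{x+y:x\in X,y\in Y\}$. For a set $S$ of nonnegative integers, $S(n)=\#(S\cap[1,n])$ and the asymptotic density is $d(S)=\lim_{n\to\infty}S(n)/n$ (required to exist). A set $B'=\{b_1<b_2<\cdots\}\subseteq\mathbb{N}$ is highly sparse if it is finite, or infinite with $b_{j+1}/b_j\to\infty$ as $j\to\infty$. *)

(* Defs.v *)
From HB Require Import structures.
From mathcomp Require Import all_boot all_order all_algebra.
From mathcomp Require Import all_classical all_reals all_analysis.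

Set Implicit Arguments.
Unset Strict Implicit.
Unset Printing Implicit Defensive.

Import Order.TTheory GRing.Theory Num.Theory.
Import numFieldNormedType.Exports.

Local Open Scope classical_set_scope.
Local Open Scope ring_scope.

Definition posnat : set nat := [set n | (0 < n)%N].

Definition sumset (X Y : set nat) : set nat :=
  [set z | exists x y : nat, [/\ X x, Y y & z = (x + y)%N]].

(* S(n) = #(S ∩ [1, n]); an element 0 of S is not counted. *)
Definition counting_fun (S : set nat) (n : nat) : nat :=
  count (fun k => k \in S) (index_iota 1 n.+1).

(* "d(S) exists and equals a"; the value 0 / 0 = 0 at n = 0 is irrelevant to
   the limit. *)
Definition has_density (R : realType) (S : set nat) (a : R) : Prop :=
  (counting_fun S n)%:R / n%:R @[n --> \oo] --> a.

(* In the second disjunct b is the increasing enumeration of the set, which is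
   then infinite.  Meant for sets of positive integers, so that every b j is
   nonzero. *)
Definition highly_sparse (R : realType) (B : set nat) : Prop :=
  finite_set B \/
  exists b : nat -> nat,
    [/\ {homo b : i j / (i < j)%N}, range b = B &
        (b j.+1)%:R / (b j)%:R @[j --> \oo] --> (+oo : set_system R)].

(* Main.v *)
(* Let c enumerate B' (if B' is finite, let c start above B' and grow like
   (m!)^5), and choose s_m -> oo with s_m^5 c_m <= c_{m+1}.  Put
   P_m = floor (c_{m+1} / s_m^2) and N_m = s_m P_m, so that
   c_m << P_m << N_m << c_{m+1}.  On the block [N_m, N_{m+1}) let A consist of
   the n whose residue modulo P_m is below alpha P_m.  Translating by c_i with
   i <= m, or by c_{m+1}, which is almost a multiple of P_m, moves residues by
   o(P_m); translates by later c_i miss the block; and sums whose first term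
   comes from an earlier block fall into the two short windows
   [N_m, N_m + c_m) and [c_{m+1}, c_{m+1} + N_m).  So on every block A + B has
   the same density as A, up to o(1). *)
Require Import Defs.
From HB Require Import structures.
From mathcomp Require Import all_boot all_order all_algebra.
From mathcomp Require Import all_classical all_reals all_analysis.
From mathcomp Require Import finmap zify lra ring.

Set Implicit Arguments.
Unset Strict Implicit.
Unset Printing Implicit Defensive.

Import Order.TTheory GRing.Theory Num.Theory.
Import numFieldNormedType.Exports.

Local Open Scope classical_set_scope.
Local Open Scope ring_scope.

(** * Counting in integer intervals and residue classes *)

Lemma sub_count_in (T : eqType) (p q : pred T) (s : seq T) :
  {in s, forall x, p x -> q x} -> (count p s <= count q s)%N.
Proof.
elim: s => //= x s IH h; apply: leq_add; last first.
  by apply: IH => y ys; apply: h; rewrite inE ys orbT.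
by case: (p x) (h x (mem_head _ _)) => // ->.
Qed.

Lemma count_predU_le (T : Type) (p q : pred T) (s : seq T) :
  (count (predU p q) s <= count p s + count q s)%N.
Proof. by rewrite -count_predUI leq_addr. Qed.

Lemma count_index_iota_cat (p : pred nat) (x y z : nat) :
  (x <= y)%N -> (y <= z)%N ->
  count p (index_iota x z) =
  (count p (index_iota x y) + count p (index_iota y z))%N.
Proof.
move=> xy yz; rewrite -count_cat /index_iota; congr count.
have -> : (z - x = (y - x) + (z - y))%N by lia.
by rewrite iotaD subnKC.
Qed.

Lemma count_window (lo hi x y : nat) :
  (count (fun k => lo <= k < hi)%N (index_iota x y) <=
   minn hi y - maxn lo x)%N.
Proof.
rewrite -size_filter.
have -> : (minn hi y - maxn lo x)%N = size (index_iota (maxn lo x) (minn hi y)).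
  by rewrite size_iota.
apply: uniq_leq_size; first by rewrite filter_uniq // iota_uniq.
by move=> k; rewrite mem_filter !mem_index_iota; lia.
Qed.

Lemma count_modn_lt (P v n : nat) : (0 < P)%N -> (v <= P)%N ->
  count (fun k => k %% P < v)%N (index_iota 0 n) =
  (n %/ P * v + minn (n %% P) v)%N.
Proof.
move=> P0 vP; elim: n => [|n IH]; first by rewrite div0n mod0n min0n.
rewrite (@count_index_iota_cat _ 0 n n.+1) // IH /index_iota subSnn /= addn0.
rewrite divnS // modnS.
have := ltn_pmod n P0.
case: (boolP (P %| n.+1)%N) => [/dvdnP[k kE]|nP].
  have -> : (n %% P = P.-1)%N.
    have -> : n = (k.-1 * P + P.-1)%N by case: k kE => [|k]; lia.
    by rewrite modnMDl modn_small // prednK.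
  by rewrite mulnDl mul1n; lia.
by rewrite add0n; lia.
Qed.

(** Starting at a multiple of [P], the interval is made of whole periods with [v] hits each and a
    last piece of length [r < P]. That piece has [minn r v] hits, at least its proportional share
    [r * v / P], so only the upper bound carries an error. *)
Lemma count_modn_lt_bounds (P v k n : nat) :
  (0 < P)%N -> (v <= P)%N -> (k * P <= n)%N ->
  let C := count (fun i => i %% P < v)%N (index_iota (k * P) n) in
  ((n - k * P) * v <= P * C)%N /\ (P * C <= (n - k * P) * v + P ^ 2)%N.
Proof.
move=> P0 vP kn C.
have := @count_modn_lt P v n P0 vP.
rewrite (@count_index_iota_cat _ 0 (k * P) n) // count_modn_lt // -/C.
rewrite mulnK // modnMl min0n addn0 => CE.
have r_lt := ltn_pmod n P0.
have nE := divn_eq n P.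
set r := (n %% P)%N in CE r_lt nE; set d := (n %/ P)%N in CE nE.
have kd : (k <= d)%N by rewrite /d leq_divRL.
have CE' : C = ((d - k) * v + minn r v)%N.
  have : (k * v <= d * v)%N by rewrite leq_mul2r kd orbT.
  by rewrite mulnBl; lia.
have -> : (n - k * P = (d - k) * P + r)%N.
  have : (k * P <= d * P)%N by rewrite leq_mul2r kd orbT.
  by rewrite mulnBl nE; lia.
have rv : (r * v <= P * minn r v)%N.
  by rewrite /minn; case: ifP => _; nia.
have Pm : (P * minn r v <= P ^ 2)%N by rewrite expnS expn1 leq_mul2l; lia.
rewrite CE' mulnDl mulnDr.
by split; nia.
Qed.

(** * The set A and its scales *)

Definition cell (c s : nat -> nat) (m : nat) : nat := (c m.+1 %/ s m ^ 2)%N.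

Definition cut (c s : nat -> nat) (m : nat) : nat := (s m * cell c s m)%N.

(** The set A, with [cell], [cut] and [u m] for P_m, N_m and the residue bound alpha P_m. *)
Definition comb (c s u : nat -> nat) : set nat :=
  [set n | exists2 m, (cut c s m <= n < cut c s m.+1)%N &
                      (n %% cell c s m < u m)%N].

Definition steep (c s : nat -> nat) : Prop :=
  [/\ (0 < c 0)%N, forall m, (0 < s m)%N &
      forall m, (s m ^ 5 * c m <= c m.+1)%N].

Lemma steep_gt0 (c s : nat -> nat) (m : nat) : steep c s -> (0 < c m)%N.
Proof.
case=> c0 s0 sc; elim: m => // m IH; apply: leq_trans (sc m).
by rewrite muln_gt0 expn_gt0 s0 IH.
Qed.

Lemma steep_homo (c s : nat -> nat) :
  steep c s -> {homo c : i j / (i <= j)%N}.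
Proof.
case=> c0 s0 sc; apply: homo_leq => //; first exact: leq_trans.
by move=> m; apply: leq_trans (sc m); rewrite leq_pmull // expn_gt0 s0.
Qed.

(** Of the five factors [s m], two are lost in the division. The remaining three make both drifts of
    residues, [c m] and [s m ^ 2], at most [cell c s m / s m]. *)
Lemma cell_ge (c s : nat -> nat) (m : nat) :
  steep c s -> (s m ^ 3 * c m <= cell c s m)%N.
Proof.
case=> c0 s0 sc; rewrite /cell leq_divRL ?expn_gt0 ?s0 //.
by rewrite mulnAC -expnD.
Qed.

Lemma cell_gt0 (c s : nat -> nat) (m : nat) : steep c s -> (0 < cell c s m)%N.
Proof.
move=> st; apply: leq_trans (cell_ge m st).
by rewrite muln_gt0 expn_gt0 (steep_gt0 m st); case: st => _ ->.
Qed.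

Lemma mul_cut_le (c s : nat -> nat) (m : nat) : (s m * cut c s m <= c m.+1)%N.
Proof. by rewrite /cut mulnA mulnn mulnC leq_divM. Qed.

Lemma cut_le (c s : nat -> nat) (m : nat) :
  steep c s -> (cut c s m <= c m.+1)%N.
Proof.
by case=> _ s0 _; apply: leq_trans (mul_cut_le c s m); rewrite leq_pmull.
Qed.

Lemma mul_le_cut (c s : nat -> nat) (m : nat) :
  steep c s -> (s m * c m <= cut c s m)%N.
Proof.
move=> st; rewrite leq_mul2l (leq_trans _ (cell_ge m st)) ?orbT //.
by rewrite leq_pmull // expn_gt0; case: st => _ ->.
Qed.

Lemma le_cut (c s : nat -> nat) (m : nat) : steep c s -> (c m <= cut c s m)%N.
Proof.
move=> st; apply: leq_trans (mul_le_cut m st).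
by rewrite leq_pmull //; case: st.
Qed.

Lemma cut_homo (c s : nat -> nat) :
  steep c s -> {homo cut c s : i j / (i <= j)%N}.
Proof.
move=> st; apply: homo_leq => //; first exact: leq_trans.
by move=> m; apply: leq_trans (cut_le m st) (le_cut m.+1 st).
Qed.

(** * A + B on a single block *)

Lemma cut_block_uniq (c s : nat -> nat) (n i j : nat) : steep c s ->
  (cut c s i <= n < cut c s i.+1)%N -> (cut c s j <= n < cut c s j.+1)%N ->
  i = j.
Proof.
move=> st /andP[i1 i2] /andP[j1 j2].
case: (ltngtP i j) => // /(cut_homo st) ?; lia.
Qed.

Lemma modnD_le (a b P : nat) : ((a + b) %% P <= a %% P + b)%N.
Proof. by rewrite -modnDml leq_mod. Qed.

(* [c m.+1] is a multiple of [cell c s m] up to a remainder below [s m ^ 2]. *)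
Lemma cell_almost_period (c s : nat -> nat) (m a : nat) : steep c s ->
  ((a + c m.+1) %% cell c s m < a %% cell c s m + s m ^ 2)%N.
Proof.
move=> st; rewrite {1}(divn_eq (c m.+1) (s m ^ 2)) -/(cell c s m).
rewrite mulnC addnCA modnMDl; apply: leq_ltn_trans (modnD_le _ _ _) _.
by rewrite ltn_add2l ltn_mod expn_gt0; case: st => _ ->.
Qed.

(** If the summand from A lies in block [m], its residue drifts by at most [c m] or by less than
    [s m ^ 2]; an earlier summand leads to one of the two windows. The alternative [b <= c 0]
    accommodates 0 and the elements of a finite B'. *)
Lemma sumset_comb_block (c s u : nat -> nat) (B : set nat) (m n : nat) :
  steep c s -> (forall b, B b -> (b <= c 0)%N \/ exists i, b = c i) ->
  (cut c s m <= n < cut c s m.+1)%N -> sumset (comb c s u) B n ->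
  [\/ (n %% cell c s m < u m + c m + s m ^ 2)%N,
      (n < cut c s m + c m)%N |
      (c m.+1 <= n < c m.+1 + cut c s m)%N].
Proof.
move=> st hB nm [a [b [[k ak au] Bb nE]]].
have s0 : (0 < s m ^ 2)%N by rewrite expn_gt0; case: st => _ ->.
have b3 : [\/ (b <= c m)%N, b = c m.+1 | (c m.+2 <= b)%N].
  case: (hB _ Bb) => [b0|[i ->]].
    by constructor 1; apply: leq_trans b0 (steep_homo st _).
  case: (ltngtP i m.+1) => im; [constructor 1|constructor 3|constructor 2].
  - by apply: (steep_homo st); lia.
  - by apply: (steep_homo st); lia.
  - by rewrite im.
have [am|am] := leqP (cut c s m) a.
  have km : k = m.
    apply: (cut_block_uniq (n := a) st) => //.
    by case/andP: nm => _; rewrite nE am /=; apply: leq_ltn_trans; lia.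
  move: b3 au; rewrite km => -[bm|bm|bm] au.
  - constructor 1; have := modnD_le a b (cell c s m); rewrite -nE; lia.
  - constructor 1; have := cell_almost_period m a st; rewrite -bm -nE; lia.
  (* Impossible: [c m.+2] is already at or beyond the end of the block. *)
  - by have := cut_le m.+1 st; lia.
case: b3 => bm.
- by constructor 2; lia.
- by constructor 3; lia.
- by have := cut_le m.+1 st; lia.
Qed.

(** Since 0 is in B, A + B contains A, and the block starts at a multiple of its period. *)
Lemma count_sumset_comb_ge (c s u : nat -> nat) (B : set nat) (m n : nat) :
  steep c s -> (u m <= cell c s m)%N -> B 0%N ->
  (cut c s m <= n <= cut c s m.+1)%N ->
  ((n - cut c s m) * u m <=
   cell c s m * count (fun k => k \in sumset (comb c s u) B)
                      (index_iota (cut c s m) n))%N.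
Proof.
move=> st uP B0 /andP[n1 n2].
have [h _] := count_modn_lt_bounds (cell_gt0 m st) uP n1.
apply: leq_trans h _; rewrite leq_mul2l sub_count_in ?orbT // => k.
rewrite mem_index_iota => /andP[k1 k2] ku.
apply/mem_set; exists k, 0%N; rewrite addn0; split=> //.
by exists m => //; apply/andP; split=> //; apply: leq_trans k2 n2.
Qed.

(** Union bound over the three cases of [sumset_comb_block]. The truncated difference [n - c m.+1]
    keeps the second window from counting before [n] reaches it; a flat [cut c s m] would not be
    small against [n] near the start of the block. *)
Lemma count_sumset_comb_le (c s u : nat -> nat) (B : set nat) (m n : nat) :
  steep c s -> (forall b, B b -> (b <= c 0)%N \/ exists i, b = c i) ->
  (cut c s m <= n <= cut c s m.+1)%N ->
  (cell c s m * count (fun k => k \in sumset (comb c s u) B)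
                      (index_iota (cut c s m) n) <=
   (n - cut c s m) * (u m + c m + s m ^ 2) + cell c s m ^ 2 +
   cell c s m * (c m + minn (cut c s m) (n - c m.+1)))%N.
Proof.
move=> st hB /andP[n1 n2].
set P := cell c s m; set N := cut c s m.
set w := (u m + c m + s m ^ 2)%N.
(* The widened bound [w] may exceed [P]; capping it loses nothing, as residues are below [P]. *)
have [_ h] := count_modn_lt_bounds (cell_gt0 m st) (geq_minr w P) n1.
pose p1 k := (k %% P < minn w P)%N.
pose p2 k := (0 <= k < N + c m)%N.
pose p3 k := (c m.+1 <= k < c m.+1 + N)%N.
have : (count (fun k => k \in sumset (comb c s u) B) (index_iota N n) <=
        count p1 (index_iota N n) + (count p2 (index_iota N n) +
        count p3 (index_iota N n)))%N.
  apply: (@leq_trans (count (predU p1 (predU p2 p3)) (index_iota N n))).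
    apply: sub_count_in => k; rewrite mem_index_iota => /andP[k1 k2] /set_mem kS.
    have km : (cut c s m <= k < cut c s m.+1)%N.
      by rewrite k1 (leq_trans k2 n2).
    have kP : (k %% P < P)%N by rewrite ltn_mod cell_gt0.
    rewrite /= /p1 /p2 /p3.
    have := sumset_comb_block st hB km kS; rewrite -/P -/N -/w.
    by case=> kk; apply/or3P; [constructor 1|constructor 2|constructor 3];
      rewrite //= leq_min kk.
  apply: leq_trans (count_predU_le _ _ _) _.
  by rewrite leq_add2l count_predU_le.
have h2 := count_window 0 (N + c m) N n.
have h3 := count_window (c m.+1) (c m.+1 + N) N n.
move=> hS; apply: leq_trans (leq_mul (leqnn P) hS) _.
rewrite mulnDr leq_add //.
  apply: leq_trans h _; rewrite leq_add2r leq_mul2l geq_minl orbT //.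
by rewrite leq_mul2l; apply/orP; right; apply: leq_add; rewrite /p2 /p3; lia.
Qed.

(** * Discrepancy estimates and the density *)

Definition threshold (R : realType) (alpha : R) (c s : nat -> nat) (m : nat) :
    nat :=
  Num.truncn (alpha * (cell c s m)%:R).

Lemma block_discrepancy (R : realType) (alpha : R) (c s : nat -> nat)
    (B : set nat) (m n : nat) :
  0 <= alpha -> alpha <= 1 -> steep c s -> B 0%N ->
  (forall b, B b -> (b <= c 0)%N \/ exists i, b = c i) ->
  (cut c s m <= n <= cut c s m.+1)%N ->
  (s m)%:R * `|(count (fun k => k \in sumset (comb c s (threshold alpha c s)) B)
                      (index_iota (cut c s m) n))%:R
               - alpha * (n%:R - (cut c s m)%:R)| <= 5 * n%:R.
Proof.
move=> a0 a1 st B0 hB nm; set u := threshold alpha c s.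
set P := cell c s m; set N := cut c s m.
have P0 : (0 < P)%N by exact: cell_gt0.
have sm0 : (0 < s m)%N by case: st.
have cm0 := steep_gt0 m st.
have cell3 := cell_ge m st; rewrite -/P in cell3.
have /andP[u1 u2] : (u m)%:R <= alpha * P%:R < (u m).+1%:R.
  by apply: truncn_itv; rewrite mulr_ge0.
have uP : (u m <= P)%N.
  by rewrite -(ler_nat R); apply: le_trans u1 _; rewrite ler_piMl.
have lo := count_sumset_comb_ge st uP B0 nm.
have hi := @count_sumset_comb_le c s u B m n st hB nm.
rewrite -/P -/N in lo hi.
set C := count _ _ in lo hi *.
case/andP: nm => Nn _; rewrite -/N in Nn.
have sP : (s m * P = N)%N by [].
have s3 : (s m <= s m ^ 3)%N by rewrite -{1}[s m]expn1 leq_pexp2l.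
have s1P : (s m <= P)%N.
  by apply: leq_trans cell3; apply: leq_trans s3 _; rewrite leq_pmulr.
have s3P : (s m * s m ^ 2 <= P)%N.
  by apply: leq_trans cell3; rewrite -expnS leq_pmulr.
have scP : (s m * c m <= P)%N.
  by apply: leq_trans cell3; rewrite leq_mul2r s3 orbT.
have scN : (s m * c m <= n)%N by apply: leq_trans Nn; exact: mul_le_cut.
have sNn : (s m * minn N (n - c m.+1) <= n)%N.
  have [nc|cn] := leqP n (c m.+1); first by nia.
  apply: leq_trans (ltnW cn); apply: leq_trans (mul_cut_le c s m).
  by rewrite leq_mul2l geq_minl orbT.
(* Five errors, each at most [n * P] after multiplication by [s m]: the drifts [c m] and [s m ^ 2],
   the incomplete period, and the two windows. *)
have hi' : (s m * P * C <= s m * (n - N) * u m + 5 * (n * P))%N.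
  rewrite -mulnA; apply: leq_trans (leq_mul (leqnn (s m)) hi) _.
  have -> : (s m * ((n - N) * (u m + c m + s m ^ 2) + P ^ 2 +
             P * (c m + minn N (n - c m.+1))) =
    s m * (n - N) * u m + ((n - N) * (s m * c m) + (n - N) * (s m * s m ^ 2) +
    s m * P * P + P * (s m * c m) + P * (s m * minn N (n - c m.+1))))%N by ring.
  rewrite leq_add2l sP.
  have -> : (5 * (n * P) = n * P + n * P + n * P + P * n + P * n)%N by ring.
  by rewrite !leq_add // leq_mul // leq_subr.
have PR : 0 < P%:R :> R by rewrite ltr0n.
have sPR : (s m)%:R <= P%:R :> R by rewrite ler_nat.
have NnR : N%:R <= n%:R :> R by rewrite ler_nat.
have N0 : 0 <= N%:R :> R by [].
have s0 : 0 <= (s m)%:R :> R by [].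
rewrite -!(ler_nat R) !natrD !natrM natrB // in lo hi'.
move: u2; rewrite -natr1 => u2.
set x := n%:R in NnR lo hi' *; set y := N%:R in NnR N0 lo hi' *.
set Cr := C%:R in lo hi' *; set p := P%:R in u1 u2 PR sPR lo hi' *.
set t := (s m)%:R in sPR s0 hi' *; set v : R := (u m)%:R in u1 u2 lo hi'.
have d0 : 0 <= t * (x - y) by rewrite mulr_ge0 // subr_ge0.
rewrite -[X in X * _]ger0_norm // -normrM ler_norml.
rewrite -(ler_pM2l PR) -[X in _ && X](ler_pM2l PR).
apply/andP; split.
  (* Rounding [alpha * P] down costs less than one residue per period, in total at most
     [t * (x - y) <= p * x]. *)
  have h1 := ler_wpM2l s0 lo.
  have h2 := ler_wpM2l d0 (ltW u2).
  have h3 : t * (x - y) <= p * x.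
    by apply: ler_pM => //; rewrite ?subr_ge0 // gerBl.
  have h4 : 0 <= p * x by rewrite mulr_ge0 // ltW.
  lra.
have h2 := ler_wpM2l d0 u1.
lra.
Qed.

(** Just after [cut c s m.+1] the previous block is not negligible, so blocks [m] and [m.+1] are
    both estimated, at cost 5 each. What precedes [cut c s m] is bounded trivially, at cost 1,
    because [K * cut c s m <= s m.+1 * c m.+1 <= n]. *)
Lemma comb_discrepancy (R : realType) (alpha : R) (c s : nat -> nat)
    (B : set nat) (K m n : nat) :
  0 <= alpha -> alpha <= 1 -> steep c s -> B 0%N ->
  (forall b, B b -> (b <= c 0)%N \/ exists i, b = c i) ->
  (K <= s m)%N -> (K <= s m.+1)%N ->
  (cut c s m.+1 <= n <= cut c s m.+2)%N ->
  K%:R * `|(count (fun k => k \in sumset (comb c s (threshold alpha c s)) B)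
                  (index_iota 1 n))%:R - alpha * n%:R| <= 11 * n%:R.
Proof.
move=> a0 a1 st B0 hB Ks Ks' nm.
set p := fun k => _.
set N := cut c s m; set N' := cut c s m.+1 in nm *.
have N1 : (0 < N)%N by apply: leq_trans (steep_gt0 m st) (le_cut m st).
have NN' : (N <= N')%N by apply: (cut_homo st).
have N'n : (N' <= n)%N by case/andP: nm.
have NN'b : (N <= N' <= N')%N by rewrite NN' leqnn.
have d1 := block_discrepancy a0 a1 st B0 hB NN'b.
have d2 := block_discrepancy a0 a1 st B0 hB nm.
have KN : (K * N <= n)%N.
  apply: leq_trans N'n; apply: leq_trans (mul_le_cut m.+1 st).
  by rewrite leq_mul // cut_le.
have CN : (count p (index_iota 1 N) <= N)%N.
  by rewrite (leq_trans (count_size _ _)) // size_iota leq_subr.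
rewrite (@count_index_iota_cat _ 1 N n) //; last exact: leq_trans N'n.
rewrite (@count_index_iota_cat _ N N' n) // !natrD.
move: d1 d2; rewrite -/p -/N -/N'.
set x := (count p (index_iota 1 N))%:R.
set y := (count p (index_iota N N'))%:R.
set z := (count p (index_iota N' n))%:R => d1 d2.
have -> : x + (y + z) - alpha * n%:R = (x - alpha * N%:R) +
   (y - alpha * (N'%:R - N%:R)) + (z - alpha * (n%:R - N'%:R)) by ring.
have xN : `|x - alpha * N%:R| <= N%:R.
  have : x <= N%:R by rewrite ler_nat.
  have : 0 <= x by [].
  have : 0 <= alpha * N%:R by rewrite mulr_ge0.
  have : alpha * N%:R <= N%:R by rewrite ler_piMl.
  by rewrite ler_norml => *; apply/andP; split; lra.
have K0 : 0 <= K%:R :> R by [].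
have e0 : K%:R * `|x - alpha * N%:R| <= n%:R.
  by apply: le_trans (ler_wpM2l K0 xN) _; rewrite -natrM ler_nat.
have e1 : K%:R * `|y - alpha * (N'%:R - N%:R)| <= 5 * n%:R.
  apply: le_trans (le_trans d1 _); first by rewrite ler_wpM2r // ler_nat.
  by rewrite ler_wpM2l // ler_nat.
have e2 : K%:R * `|z - alpha * (n%:R - N'%:R)| <= 5 * n%:R.
  by apply: le_trans d2; rewrite ler_wpM2r // ler_nat.
move: e0 e1 e2; set X := x - _; set Y := y - _; set Z := z - _ => e0 e1 e2.
have := ler_wpM2l K0 (ler_normD (X + Y) Z).
have := ler_wpM2l K0 (ler_normD X Y).
lra.
Qed.

Lemma cut_block_ex (c s : nat -> nat) (m n : nat) : steep c s ->
  (forall K, exists M, forall m, (M <= m)%N -> (K <= s m)%N) ->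
  (cut c s m <= n)%N ->
  exists2 k, (m <= k)%N & (cut c s k <= n < cut c s k.+1)%N.
Proof.
move=> st s_oo mn.
have exk : exists k, (n < cut c s k)%N.
  have [M hM] := s_oo n.+1; exists M.
  apply: leq_trans (hM M (leqnn M)) _; apply: leq_trans (mul_le_cut M st).
  by rewrite leq_pmulr // (steep_gt0 M st).
case: (ex_minnP exk) => k nk kmin.
have mk : (m < k)%N.
  by rewrite ltnNge; apply/negP => /(cut_homo st) km; lia.
case: k mk nk kmin => // k mk nk kmin; exists k => //.
by rewrite nk andbT leqNgt; apply/negP => /kmin; rewrite ltnn.
Qed.

Lemma steep_sumset_density (R : realType) (alpha : R) (c s : nat -> nat)
    (B : set nat) :
  0 <= alpha -> alpha <= 1 -> steep c s ->
  (forall K, exists M, forall m, (M <= m)%N -> (K <= s m)%N) -> B 0%N ->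
  (forall b, B b -> (b <= c 0)%N \/ exists i, b = c i) ->
  has_density (sumset (comb c s (threshold alpha c s)) B) alpha.
Proof.
move=> a0 a1 st s_oo B0 hB; apply/cvgrPdist_le => e e0.
(* 23 = 11 + 11 + 1: the discrepancy at [n.+1] is at most 11 (n + 1) <= 22 n, and passing from
   [alpha * (n + 1)] to [alpha * n] costs at most [K <= n]. *)
pose K := (Num.truncn (23 / e)).+1.
have KE : 23 <= e * K%:R.
  have /truncn_itv/andP[_ h] : 0 <= 23 / e by rewrite divr_ge0 // ltW.
  by rewrite -ler_pdivrMl // mulrC ltW.
have [M hM] := s_oo K.
(* Starting at [M.+1] ensures that the block before that of [n.+1] also has [s] at least [K]. *)
exists (K + cut c s M.+1)%N => // n /= nM.
have Nn : (cut c s M.+1 <= n.+1)%N by lia.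
have [k Mk nk] := cut_block_ex st s_oo Nn.
case: k Mk nk => // k Mk nk.
have nk' : (cut c s k.+1 <= n.+1 <= cut c s k.+2)%N by lia.
have := @comb_discrepancy R alpha c s B K k n.+1 a0 a1 st B0 hB
  (hM k Mk) (hM k.+1 (leqW Mk)) nk'.
rewrite /counting_fun -natr1.
set C := (count _ _)%:R => hC.
have nK : K%:R <= n%:R :> R by rewrite ler_nat; lia.
have K1 : 1 <= K%:R :> R by rewrite ler1n.
set x := n%:R in hC nK *; set y := K%:R in KE K1 hC nK.
have x0 : 0 < x by lra.
have y0 : 0 < y by lra.
have -> : alpha - C / x = (alpha * x - C) / x by field; lra.
rewrite normrM normfV (gtr0_norm x0) ler_pdivrMr // -(ler_pM2l y0).
have tri : `|alpha * x - C| <= `|C - alpha * (x + 1)| + 1.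
  have -> : alpha * x - C = - (C - alpha * (x + 1)) - alpha by ring.
  by apply: le_trans (ler_normB _ _) _; rewrite normrN (ger0_norm a0) lerD2l.
apply: le_trans (ler_wpM2l (ltW y0) tri) _.
rewrite mulrDr mulr1.
have := ler_wpM2r (ltW x0) KE; lra.
Qed.

(** * Steep sequences from highly sparse sets *)

Lemma finite_set_steep (B : set nat) : finite_set B ->
  exists c s : nat -> nat,
    [/\ steep c s, forall K, exists M, forall m, (M <= m)%N -> (K <= s m)%N &
        forall b, B b -> (b <= c 0)%N \/ exists i, b = c i].
Proof.
move=> /finite_fsetP[X ->].
pose M := (\max_(i <- X) i)%N.
exists (fun m => M.+1 * m`! ^ 5)%N, succn; split.
- split=> // m.
  by rewrite factS expnMn mulnCA.
- by move=> K; exists K => m; apply: leqW.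
- move=> b /= bX; left; rewrite muln1 leqW //.
  by apply: (@leq_bigmax_seq _ (enum_fset X) xpredT id b).
Qed.

(** Take for [s m] the largest [i] with [i ^ 5 * b m <= b m.+1]. The value 1 is admissible because
    [b] increases, and [K] is admissible once the ratio reaches [K ^ 5]. *)
Lemma sparse_enum_steep (R : realType) (b : nat -> nat) :
  (0 < b 0)%N -> {homo b : i j / (i < j)%N} ->
  (b j.+1)%:R / (b j)%:R @[j --> \oo] --> (+oo : set_system R) ->
  exists2 s : nat -> nat, steep b s &
    forall K, exists M, forall m, (M <= m)%N -> (K <= s m)%N.
Proof.
move=> b0 b_incr /cvgryPge b_oo.
have bgt0 m : (0 < b m)%N.
  by case: m => // m; apply: leq_trans (b_incr 0%N m.+1 _).
pose p m i := (i ^ 5 * b m <= b m.+1)%N.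
have p1 m : exists i, p m i.
  by exists 1%N; rewrite /p exp1n mul1n ltnW // b_incr.
have pb m i : p m i -> (i <= b m.+1)%N.
  apply: leq_trans; apply: (@leq_trans (i ^ 5)); last by rewrite leq_pmulr.
  by case: i => // i; rewrite -{1}[i.+1]expn1 leq_pexp2l.
exists (fun m => ex_maxn (p1 m) (@pb m)).
  split=> // m; case: ex_maxnP => // i pi imax.
  by apply: imax; rewrite /p exp1n mul1n ltnW // b_incr.
move=> K; have [M _ hM] := b_oo ((K ^ 5)%N%:R).
exists M => m /hM; rewrite ler_pdivlMr ?ltr0n // -natrM ler_nat => pK.
by case: ex_maxnP => i _; apply.
Qed.

Theorem theorem3p2 (R : realType) (alpha : R) (B' : set nat)
    (alpha_ge0 : 0 <= alpha) (alpha_le1 : alpha <= 1)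
    (B'_pos : B' `<=` posnat) (B'_sparse : highly_sparse R B') :
  exists A : set nat,
    A `<=` posnat /\ has_density (sumset A ([set 0%N] `|` B')) alpha.
Proof.
have [c [s [st s_oo hB]]] : exists c s : nat -> nat,
    [/\ steep c s, forall K, exists M, forall m, (M <= m)%N -> (K <= s m)%N &
        forall b, B' b -> (b <= c 0)%N \/ exists i, b = c i].
  case: B'_sparse => [/finite_set_steep //|[b [b_incr bE b_oo]]].
  have b0 : (0 < b 0)%N by apply: B'_pos; rewrite -bE; exists 0%N.
  have [s st s_oo] := sparse_enum_steep b0 b_incr b_oo.
  exists b, s; split=> // x; rewrite -bE => -[i _ <-].
  by right; exists i.
exists (comb c s (threshold alpha c s)); split.
  move=> n [m /andP[mn _] _]; rewrite /posnat /=.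
  by apply: leq_trans mn; apply: leq_trans (steep_gt0 m st) (le_cut m st).
apply: steep_sumset_density => //; first by left.
by move=> b [->|/hB //]; left.
Qed.
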